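(* Let $\bm{y},\bm{a}\in\mathbb{R}^n$, $b\in\mathbb{R}$, and let $\psi(\sigma)=\bm{a}^\top\Pi_{\Delta_{n-1}}(\bm{y}-\sigma\bm{a})-b$. Fix $\sigma>0$ and let $\kappa^\sigma,\bar K(\sigma),\gamma_1(\sigma),\gamma_2(\sigma),\kappa^\sigma_+$ be as defined in the context. Then the one-sided derivatives $\psi'_+(\sigma)$ and $\psi'_-(\sigma)$ exist, the generalized Clarke differential of $\psi$ at $\sigma$ is $$\partial\psi(\sigma)=\{\alpha\psi'_+(\sigma)+(1-\alpha)\psi'_-(\sigma) : \alpha\in[0,1]\},$$ and the one-sided derivatives are given as follows. (1) If $\gamma_2(\sigma)=\emptyset$, then $$\psi'_+(\sigma)=\psi'_-(\sigma)=\sum_{i\in\gamma_1(\sigma)}\bm{a}_i\left(-\bm{a}_i+\frac{\sum_{j\in\gamma_1(\sigma)}\bm{a}_j}{|\gamma_1(\sigma)|}\right).$$ (2) If $\gamma_2(\sigma)\ne\emptyset$, let $\tilde\lambda_+(\sigma)$ be the largest $i\in\{1,\dots,|\gamma_2(\sigma)|\}$ such that $$-\bm{a}_{\kappa^\sigma_+(i)}+\frac{1}{\bar K(\sigma)+i}\left(\sum_{j=1}^{\bar K(\sigma)}\bm{a}_{\kappa^\sigma(j)}+\sum_{j=1}^{i}\bm{a}_{\kappa^\sigma_+(j)}\right)>0$$ (and $\tilde\lambda_+(\sigma)=0$ if there is no such $i$), and let $\tilde\lambda_-(\sigma)$ be the smallest $i\in\{1,\dots,|\gamma_2(\sigma)|\}$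 such that $$-\bm{a}_{\kappa^\sigma_+(i)}+\frac{1}{\bar K(\sigma)+|\gamma_2(\sigma)|+1-i}\left(\sum_{j=1}^{\bar K(\sigma)}\bm{a}_{\kappa^\sigma(j)}+\sum_{j=i}^{|\gamma_2(\sigma)|}\bm{a}_{\kappa^\sigma_+(j)}\right)<0$$ (and $\tilde\lambda_-(\sigma)=|\gamma_2(\sigma)|+1$ if there is no such $i$). Put $$\tilde\zeta_+=\frac{\sum_{j=1}^{\bar K(\sigma)}\bm{a}_{\kappa^\sigma(j)}+\sum_{j=1}^{\tilde\lambda_+(\sigma)}\bm{a}_{\kappa^\sigma_+(j)}}{\bar K(\sigma)+\tilde\lambda_+(\sigma)},\qquad \tilde\zeta_-=\frac{\sum_{j=1}^{\bar K(\sigma)}\bm{a}_{\kappa^\sigma(j)}+\sum_{j=\tilde\lambda_-(\sigma)}^{|\gamma_2(\sigma)|}\bm{a}_{\kappa^\sigma_+(j)}}{\bar K(\sigma)+|\gamma_2(\sigma)|+1-\tilde\lambda_-(\sigma)}.$$ Then $$\psi'_+(\sigma)=\sum_{i\in\gamma_2(\sigma)}\bm{a}_i\max(-\bm{a}_i+\tilde\zeta_+,0)+\sum_{i\in\gamma_1(\sigma)}\bm{a}_i(-\bm{a}_i+\tilde\zeta_+),$$ $$\psi'_-(\sigma)=\sum_{i\in\gamma_2(\sigma)}\bm{a}_i\min(-\bm{a}_i+\tilde\zeta_-,0)+\sum_{i\in\gamma_1(\sigma)}\bm{a}_i(-\bm{a}_i+\tilde\zeta_-).$$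
   Context: $\Delta_{n-1}=\{\bm{x}\in\mathbb{R}^n:\sum_i\bm{x}_i=1,\ \bm{x}\ge0\}$ is the simplex and $\Pi_{\Delta_{n-1}}$ is the Euclidean projection onto it. For $\sigma\ge0$, $\kappa^\sigma$ is a permutation of $\{1,\dots,n\}$ with $(\bm{y}-\sigma\bm{a})_{\kappa^\sigma(1)}\ge\cdots\ge(\bm{y}-\sigma\bm{a})_{\kappa^\sigma(n)}$, and $$\bar K(\sigma)=\max\Big\{1\le j\le n:\ (\bm{y}-\sigma\bm{a})_{\kappa^\sigma(j)}+\tfrac1j\Big(1-\sum_{i=1}^j(\bm{y}-\sigma\bm{a})_{\kappa^\sigma(i)}\Big)>0\Big\}.$$ Write $\tau(\sigma)=\frac{1}{\bar K(\sigma)}\Big(\sum_{j=1}^{\bar K(\sigma)}(\bm{y}-\sigma\bm{a})_{\kappa^\sigma(j)}-1\Big)$. (It is known that $\Pi_{\Delta_{n-1}}(\bm{y}-\sigma\bm{a})_i=\max((\bm{y}-\sigma\bm{a})_i-\tau(\sigma),0)$.) Define $\gamma_1(\sigma)=\{i:(\bm{y}-\sigma\bm{a})_i-\tau(\sigma)>0\}$ and $\gamma_2(\sigma)=\{i:(\bm{y}-\sigma\bm{a})_i-\tau(\sigma)=0\}$; thus $\gamma_1(\sigma)=\{\kappa^\sigma(1),\dots,\kappa^\sigma(\bar K(\sigma))\}$ and $\gamma_2(\sigma)=\{\kappa^\sigma(\bar K(\sigma)+1),\dots,\kappa^\sigma(\bar K(\sigma)+|\gamma_2(\sigma)|)\}$.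 When $\gamma_2(\sigma)\neq\emptyset$, $\kappa^\sigma_+:\{1,\dots,|\gamma_2(\sigma)|\}\to\gamma_2(\sigma)$ is a bijection with $-\bm{a}_{\kappa^\sigma_+(1)}\ge\cdots\ge-\bm{a}_{\kappa^\sigma_+(|\gamma_2(\sigma)|)}$. One-sided derivatives: $\psi'_+(\sigma)=\lim_{t\downarrow0}\frac{\psi(\sigma+t)-\psi(\sigma)}{t}$, $\psi'_-(\sigma)=\lim_{t\uparrow0}\frac{\psi(\sigma+t)-\psi(\sigma)}{t}$. The generalized Clarke differential is $\partial\psi(\sigma)=\mathrm{conv}\{\lim_{k\to\infty}\psi'(\sigma_k):\sigma_k\to\sigma,\ \psi \text{ differentiable at each }\sigma_k\}$. Empty sums are $0$. *)

(* Defs.v *)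
From mathcomp Require Import all_boot all_order all_algebra all_fingroup.
From mathcomp Require Import all_classical all_reals all_analysis.

Set Implicit Arguments.
Unset Strict Implicit.
Unset Printing Implicit Defensive.

Import Order.TTheory GRing.Theory Num.Theory.
Import numFieldNormedType.Exports.

Local Open Scope ring_scope.

(** * Projection onto the simplex *)

Definition simplex (R : realType) (n : nat) : set 'cV[R]_n :=
  [set x | \sum_(i < n) x i 0 = 1 /\ (forall i, 0 <= x i 0)]%classic.

(* The norm that MathComp-Analysis puts on matrices is the sup norm. *)
Definition enorm (R : realType) (n : nat) (x : 'cV[R]_n) : R :=
  Num.sqrt (\sum_(i < n) x i 0 ^+ 2).

Definition nearest (R : realType) (n : nat) (C : set 'cV[R]_n)
    (z : 'cV[R]_n) : set 'cV[R]_n :=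
  [set p | C p /\ (forall q, C q -> enorm (z - p) <= enorm (z - q))]%classic.

(* For n > 0 the simplex is nonempty, compact and convex, so there is exactly
   one nearest point and the default value 0 is not used. *)
Definition proj_simplex (R : realType) (n : nat) (z : 'cV[R]_n) : 'cV[R]_n :=
  xget 0 (nearest (@simplex R n) z).

Definition psi (R : realType) (n : nat) (y a : 'cV[R]_n) (b s : R) : R :=
  (a^T *m proj_simplex (y - s *: a)) 0 0 - b.

(** * Sorting, threshold and index sets

    Below z stands for y - sigma a. Positions are ordinals, hence 0-based: the
    1-based position j is the ordinal of value j - 1. The quantities Kbar,
    lambda_plus and lambda_minus are 1-based natural numbers. *)

Definition sorts_decreasing (R : realType) (n m : nat) (v : 'cV[R]_n)
    (k : 'I_m -> 'I_n) : Prop :=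
  forall i j : 'I_m, (i <= j)%N -> v (k j) 0 <= v (k i) 0.

(* v_(k(1)) + ... + v_(k(l)) in 1-based positions *)
Definition prefix_sum (R : realType) (n m : nat) (v : 'cV[R]_n)
    (k : 'I_m -> 'I_n) (l : nat) : R :=
  \sum_(j < m | (j.+1 <= l)%N) v (k j) 0.

(* v_(k(l)) + ... + v_(k(m)) in 1-based positions *)
Definition suffix_sum (R : realType) (n m : nat) (v : 'cV[R]_n)
    (k : 'I_m -> 'I_n) (l : nat) : R :=
  \sum_(j < m | (l <= j.+1)%N) v (k j) 0.

Definition Kbar (R : realType) (n : nat) (z : 'cV[R]_n)
    (kap : 'I_n -> 'I_n) : nat :=
  \max_(j < n |
    0 < z (kap j) 0 + j.+1%:R^-1 * (1 - prefix_sum z kap j.+1)) j.+1.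

Definition tau (R : realType) (n : nat) (z : 'cV[R]_n)
    (kap : 'I_n -> 'I_n) : R :=
  (Kbar z kap)%:R^-1 * (prefix_sum z kap (Kbar z kap) - 1).

Definition gamma1 (R : realType) (n : nat) (z : 'cV[R]_n)
    (kap : 'I_n -> 'I_n) : {set 'I_n} :=
  [set i | 0 < z i 0 - tau z kap]%SET.

Definition gamma2 (R : realType) (n : nat) (z : 'cV[R]_n)
    (kap : 'I_n -> 'I_n) : {set 'I_n} :=
  [set i | z i 0 - tau z kap == 0]%SET.

(** * The data of the degenerate case

    K stands for Kbar, and kapp : 'I_m -> 'I_n for the enumeration of gamma2. *)

Definition mean_plus (R : realType) (n m : nat) (a : 'cV[R]_n)
    (kap : 'I_n -> 'I_n) (K : nat) (kapp : 'I_m -> 'I_n) (i : nat) : R :=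
  (prefix_sum a kap K + prefix_sum a kapp i) / (K + i)%:R.

(* The empty maximum is 0. *)
Definition lambda_plus (R : realType) (n m : nat) (a : 'cV[R]_n)
    (kap : 'I_n -> 'I_n) (K : nat) (kapp : 'I_m -> 'I_n) : nat :=
  \max_(i < m | 0 < - a (kapp i) 0 + mean_plus a kap K kapp i.+1) i.+1.

Definition zeta_plus (R : realType) (n m : nat) (a : 'cV[R]_n)
    (kap : 'I_n -> 'I_n) (K : nat) (kapp : 'I_m -> 'I_n) : R :=
  mean_plus a kap K kapp (lambda_plus a kap K kapp).

(* The subtraction is only used for i <= m + 1, where it is exact. *)
Definition mean_minus (R : realType) (n m : nat) (a : 'cV[R]_n)
    (kap : 'I_n -> 'I_n) (K : nat) (kapp : 'I_m -> 'I_n) (i : nat) : R :=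
  (prefix_sum a kap K + suffix_sum a kapp i) / (K + m + 1 - i)%:R.

(* The empty minimum is m + 1. *)
Definition lambda_minus (R : realType) (n m : nat) (a : 'cV[R]_n)
    (kap : 'I_n -> 'I_n) (K : nat) (kapp : 'I_m -> 'I_n) : nat :=
  \big[minn/m.+1]_(i < m |
    - a (kapp i) 0 + mean_minus a kap K kapp i.+1 < 0) i.+1.

Definition zeta_minus (R : realType) (n m : nat) (a : 'cV[R]_n)
    (kap : 'I_n -> 'I_n) (K : nat) (kapp : 'I_m -> 'I_n) : R :=
  mean_minus a kap K kapp (lambda_minus a kap K kapp).

(** * One-sided derivatives and the Clarke differential *)

Definition diff_quotient (R : realType) (f : R -> R) (x t : R) : R :=
  (f (x + t) - f x) / t.

Definition right_derivable (R : realType) (f : R -> R) (x : R) : Prop :=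
  cvg (diff_quotient f x t @[t --> 0^'+])%classic.

Definition left_derivable (R : realType) (f : R -> R) (x : R) : Prop :=
  cvg (diff_quotient f x t @[t --> 0^'-])%classic.

Definition right_derivative (R : realType) (f : R -> R) (x : R) : R :=
  lim (diff_quotient f x t @[t --> 0^'+])%classic.

Definition left_derivative (R : realType) (f : R -> R) (x : R) : R :=
  lim (diff_quotient f x t @[t --> 0^'-])%classic.

Definition conv_hull (R : realType) (A : set R) : set R :=
  smallest (@convex_set R R^o) A.

Definition clarke (R : realType) (f : R -> R) (x : R) : set R :=
  conv_hull [set l : R | exists s : nat -> R,
    [/\ s @ \oo --> x,
        forall k, derivable f (s k) 1 &
        (fun k => f^`() (s k)) @ \oo --> l]]%classic.

(* Main.v *)
Require Import Defs.
From mathcomp Require Import all_boot all_order all_algebra all_fingroup.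
From mathcomp Require Import all_classical all_reals all_analysis.
From mathcomp Require Import ring lra zify.

Import Order.TTheory GRing.Theory Num.Theory.
Import numFieldNormedType.Exports.

Local Open Scope ring_scope.

(** The projection of z is max(z - t, 0) for the threshold t that gives it mass
    1. If z moves in a direction d, then for small steps the threshold moves
    linearly, with the slope zeta for which the rates of change of the
    coordinates (d_i - zeta on gamma1, max(d_i - zeta, 0) on gamma2, 0
    elsewhere) sum to 0. So psi is affine on a short interval on either side of
    sigma, with slopes given by d = - a on the right and d = a on the left, and
    the limits of derivatives near sigma are exactly these two slopes. The
    thresholds tau, zeta_plus and zeta_minus are all computed by the same
    greedy rule on a sorted sequence. *)

(** * Largest and smallest index passing a test *)

(** Keeps the two facts that the greedy rule uses: the last index taken passes the test and the next
    one fails it. Indices are 0-based and [l] is 1-based, so these are [j.+1 = l] and [j = l];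
    either clause is vacuous when [l] lies at that end of the range. *)
Lemma bigmax_succP (m : nat) (P : pred 'I_m) (l := (\max_(j < m | P j) j.+1)%N) :
  [/\ (l <= m)%N, forall j : 'I_m, j.+1 = l -> P j
    & forall j : 'I_m, j = l :> nat -> ~~ P j].
Proof.
split.
- by apply/bigmax_leqP.
- move=> j jl; have [i Pi|P0] := pickP P.
    have [i0 Pi0 li0] : {i0 : 'I_m | P i0 & l = i0.+1}.
      by apply: eq_bigmax_cond; apply/card_gt0P; exists i.
    by rewrite (_ : j = i0)//; apply: val_inj; apply: succn_inj; rewrite jl.
  by move: jl; rewrite /l big_pred0.
- move=> j jl; apply/negP => Pj.
  by have := @leq_bigmax_cond _ P (fun i : 'I_m => i.+1) j Pj; rewrite -/l -jl ltnn.
Qed.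

Lemma bigmin_succP (m : nat) (P : pred 'I_m)
    (l := (\big[minn/m.+1]_(j < m | P j) j.+1)%N) :
  [/\ (0 < l <= m.+1)%N, forall j : 'I_m, j.+1 = l -> P j
    & forall j : 'I_m, j.+2 = l -> ~~ P j].
Proof.
have lP j : P j -> (l <= j.+1)%N.
  rewrite /l; elim: (index_enum _) (mem_index_enum j) => [//|i r IH].
  rewrite inE big_cons => /predU1P[<- Pj|/IH{}IH Pj]; first by rewrite Pj geq_minl.
  by case: ifP => _; rewrite ?geq_min IH ?orbT.
split.
- apply: (big_ind (fun k => (0 < k <= m.+1)%N)) => [|x y /andP[x0 xm] /andP[y0 ym]|i _].
  + by rewrite ltn0Sn leqnn.
  + by rewrite /minn; case: ifP; rewrite ?x0 ?y0.
  + by rewrite ltn0Sn ltnW// ltnS ltn_ord.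
(* The minimum is the default [m.+1], which is no [j.+1] with [j < m], or it is attained at an index
   passing the test. *)
- suff : l = m.+1 \/ exists2 i : 'I_m, P i & l = i.+1.
    move=> [-> j [jm]|[i Pi ->] j [ji]]; first by have := ltn_ord j; rewrite jm ltnn.
    by rewrite (_ : j = i)//; exact: val_inj.
  rewrite /l; elim/big_ind: _ => [|x y [->|[i Pi ->]] [->|[j Pj ->]]|i Pi].
  + by left.
  + by left; rewrite minnn.
  + by right; exists j => //; apply/minn_idPr; have := ltn_ord j; lia.
  + by right; exists i => //; apply/minn_idPl; have := ltn_ord i; lia.
  + by right; case: (leqP i j) => ij; [exists i|exists j] => //; lia.
  + by right; exists i.
- by move=> j jl; apply/negP => /lP; rewrite -jl ltnn.
Qed.

(** * The greedy threshold of a decreasing sequence *)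

Section Threshold.
Variables (R : realType) (m : nat) (w : 'I_m -> R) (c : R) (K l : nat).
(** For [K + k > 0], [avg k] is the root [x] of the equation stating that the differences [w j - x]
    over [j < k] sum to [K x - c], that is, the right threshold if exactly the first [k] terms
    exceed it. *)
Let avg k := (c + \sum_(j < m | (j < k)%N) w j) / (K + k)%:R.
Hypotheses (w_decr : forall i j : 'I_m, (i <= j)%N -> w j <= w i)
  (Kl_gt0 : (0 < K + l)%N) (l_le : (l <= m)%N)
  (last_gt : forall j : 'I_m, j.+1 = l -> avg l < w j)
  (next_le : forall j : 'I_m, j = l :> nat -> w j <= avg l.+1).

(** [avg l.+1] is a weighted mean of [avg l] and the first dropped term, so a dropped term at most
    [avg l.+1] is also at most [avg l]. Monotonicity carries the two tests around [l] to all other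
    indices. *)
Lemma sorted_threshold (j : 'I_m) : (avg l < w j) = (j < l)%N.
Proof.
case: ltnP => [jl|lj].
  have lm : (l.-1 < m)%N by lia.
  rewrite (@lt_le_trans _ _ (w (Ordinal lm)))//.
    by apply: last_gt => /=; lia.
  by apply: w_decr => /=; lia.
apply/negbTE; rewrite -leNgt.
have lm : (l < m)%N by apply: leq_ltn_trans lj _.
apply: (@le_trans _ _ (w (Ordinal lm))); first exact: w_decr.
have := next_le (Ordinal lm) erefl; rewrite /avg (bigD1 (Ordinal lm)) //=.
rewrite (eq_bigl (fun j : 'I_m => (j < l)%N)); last first.
  by move=> i; rewrite -val_eqE/=; lia.
rewrite ler_pdivlMr ?ltr0n ?addnS// ler_pdivlMr ?ltr0n// -natr1.
by lra.
Qed.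

Lemma sorted_threshold_sum :
  \sum_j Num.max (w j - avg l) 0 = K%:R * avg l - c.
Proof.
rewrite (bigID (fun j : 'I_m => (j < l)%N))/= addrC big1 ?add0r; last first.
  by move=> j; rewrite -sorted_threshold -leNgt => ?; apply/max_idPr; lra.
rewrite (eq_bigr (fun j => w j - avg l)); last first.
  by move=> j; rewrite -sorted_threshold => ?; apply/max_idPl; lra.
rewrite big_split/= sumr_const.
rewrite (_ : #|_| = l); last first.
  by rewrite -[RHS]card_ord -sum1_card (big_ord_narrow l_le) sum1_card.
have : (K + l)%:R * avg l = c + \sum_(j < m | (j < l)%N) w j.
  by rewrite mulrC divfK// pnatr_eq0; lia.
rewrite natrD -mulr_natr.
by move=> h; lra.
Qed.
End Threshold.

(** * The thresholds [tau], [zeta_plus] and [zeta_minus] as greedy thresholds *)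

Lemma Kbar_gt0 (R : realType) (n : nat) (z : 'cV[R]_n) (kap : 'I_n -> 'I_n) :
  (0 < n)%N -> (0 < Kbar z kap)%N.
Proof.
move=> n_gt0.
apply: leq_trans (@leq_bigmax_cond _ _ (fun i : 'I_n => i.+1) (Ordinal n_gt0) _).
  by [].
rewrite /prefix_sum (big_pred1 (Ordinal n_gt0)) => [|i]; last first.
  by rewrite /= -val_eqE /=; lia.
(* At the first position the test reads [0 < z + (1 - z)], which always holds. *)
by rewrite invr1; lra.
Qed.

(** Puts [tau] in the form [avg] of the greedy rule with [c = -1] and [K = 0]; the balance equation
    then says that the positive parts have mass 1. *)
Lemma tau_avg (R : realType) (n : nat) (z : 'cV[R]_n) (kap : 'I_n -> 'I_n) :
  tau z kap = (-1 + prefix_sum z kap (Kbar z kap)) / (0 + Kbar z kap)%:R.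
Proof. by rewrite add0n /tau mulrC addrC. Qed.

Section KbarTau.
Variables (R : realType) (n : nat) (z : 'cV[R]_n) (kap : 'S_n).
Hypotheses (n_gt0 : (0 < n)%N) (kap_sorts : sorts_decreasing z kap).

Let Kprem : let K := Kbar z kap in
  [/\ (K <= n)%N, forall j : 'I_n, j.+1 = K -> tau z kap < z (kap j) 0
  & forall j : 'I_n, j = K :> nat ->
    z (kap j) 0 <= (-1 + prefix_sum z kap K.+1) / (0 + K.+1)%:R].
Proof.
have [Kn KP KNP] := bigmax_succP n (fun j : 'I_n =>
  0 < z (kap j) 0 + j.+1%:R^-1 * (1 - prefix_sum z kap j.+1)).
split => // j jK.
  by move: (KP _ jK); rewrite tau_avg add0n jK -/(Kbar _ _); set k := _^-1; lra.
move: (KNP _ jK); rewrite -leNgt add0n jK -/(Kbar _ _).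
by set k := _^-1; lra.
Qed.

Lemma tau_lt (j : 'I_n) : (tau z kap < z (kap j) 0) = (j < Kbar z kap)%N.
Proof.
have [Kn KP KNP] := Kprem; rewrite tau_avg.
apply: (@sorted_threshold R n (fun j => z (kap j) 0)) => //.
  by rewrite add0n Kbar_gt0.
by move=> i /KP; rewrite tau_avg.
Qed.

Lemma tau_sum : \sum_i Num.max (z i 0 - tau z kap) 0 = 1.
Proof.
have [Kn KP KNP] := Kprem; rewrite (reindex_inj (@perm_inj _ kap))/= tau_avg.
rewrite (@sorted_threshold_sum R n (fun j => z (kap j) 0) (-1) 0)//.
- by rewrite mul0r sub0r opprK.
- by rewrite add0n Kbar_gt0.
- by move=> i /KP; rewrite tau_avg.
Qed.

Lemma gamma1_sum (a : 'cV[R]_n) :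
  \sum_(i in gamma1 z kap) a i 0 = prefix_sum a kap (Kbar z kap).
Proof.
rewrite (reindex_inj (@perm_inj _ kap))/=; apply: eq_bigl => j.
by rewrite inE subr_gt0 tau_lt.
Qed.

Lemma card_gamma1 : #|gamma1 z kap| = Kbar z kap.
Proof.
have [Kn _ _] := Kprem.
rewrite -sum1_card (reindex_inj (@perm_inj _ kap))/=.
rewrite (eq_bigl (fun j : 'I_n => (j < Kbar z kap)%N)); last first.
  by move=> j; rewrite inE subr_gt0 tau_lt.
by rewrite (big_ord_narrow Kn) sum1_card card_ord.
Qed.

End KbarTau.

(* With [kapp] enumerating gamma2, the right-hand sides are minus the sum over
   gamma1 of [- a i - (- zeta)], respectively of [a i - zeta], so the lemmas say
   that the rates of change of the coordinates sum to 0. *)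
Section Zeta.
Variables (R : realType) (n m : nat) (a : 'cV[R]_n) (kap : 'I_n -> 'I_n).
Variables (K : nat) (kapp : 'I_m -> 'I_n).
Hypotheses (K_gt0 : (0 < K)%N) (kapp_sorts : sorts_decreasing (- a) kapp).

Lemma zeta_plus_balance (zeta := zeta_plus a kap K kapp) :
  \sum_j Num.max (- a (kapp j) 0 + zeta) 0
  = prefix_sum a kap K - K%:R * zeta.
Proof.
have [lm lP lNP] := bigmax_succP m (fun i : 'I_m =>
  0 < - a (kapp i) 0 + mean_plus a kap K kapp i.+1).
(* The greedy rule is applied to [- a] along [kapp], with the [K] entries of gamma1 always counted;
   its threshold is therefore minus [zeta_plus]. *)
pose avg k := (- prefix_sum a kap K + \sum_(j < m | (j < k)%N) - a (kapp j) 0)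
              / (K + k)%:R.
have avgE k : avg k = - mean_plus a kap K kapp k.
  by rewrite /avg /mean_plus /prefix_sum sumrN -opprD mulNr.
have := @sorted_threshold_sum R m (fun j => - a (kapp j) 0)
  (- prefix_sum a kap K) K (lambda_plus a kap K kapp).
rewrite -/(avg _) avgE !opprK mulrN => -> //.
- by rewrite addrC.
- by move=> i j /kapp_sorts; rewrite !mxE.
- by rewrite addn_gt0 K_gt0.
- by move=> j jl; move: (lP j jl); rewrite jl -/(lambda_plus _ _ _ _); lra.
- move=> j jl; rewrite -/(avg _) avgE; move: (lNP j jl).
  by rewrite jl -/(lambda_plus _ _ _ _); lra.
Qed.

Lemma zeta_minus_balance (zeta := zeta_minus a kap K kapp) :
  \sum_j Num.max (a (kapp j) 0 - zeta) 0
  = K%:R * zeta - prefix_sum a kap K.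
Proof.
have [/andP[l_gt0 lm] lP lNP] := bigmin_succP m (fun i : 'I_m =>
  - a (kapp i) 0 + mean_minus a kap K kapp i.+1 < 0).
rewrite -/(lambda_minus a kap K kapp) in l_gt0 lm lP lNP.
set l := lambda_minus a kap K kapp in l_gt0 lm lP lNP.
(* Reversing the order turns the smallest index into a largest one. *)
pose w (j : 'I_m) := a (kapp (rev_ord j)) 0.
pose avg k := (prefix_sum a kap K + \sum_(j < m | (j < k)%N) w j) / (K + k)%:R.
(* The terms from 1-based position [k] on are the first [m.+1 - k] terms of the reversed
   sequence. *)
have avgE k : (k <= m.+1)%N -> avg (m.+1 - k)%N = mean_minus a kap K kapp k.
  move=> km; rewrite /avg /mean_minus /suffix_sum; congr ((_ + _) / _%:R); last by lia.
  rewrite (reindex_inj rev_ord_inj)/=; apply: eq_big => j.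
    by have := ltn_ord j; lia.
  by rewrite /w rev_ordK.
rewrite (reindex_inj rev_ord_inj)/= /zeta /zeta_minus -/l -avgE//.
apply: sorted_threshold_sum => //.
- by move=> i j ij; have := @kapp_sorts (rev_ord j) (rev_ord i);
    rewrite !mxE lerN2; apply=> /=; lia.
- by lia.
- by lia.
- move=> j jl; rewrite -/(avg _) avgE//.
  have jm := ltn_ord j.
  have jl' : (rev_ord j).+1 = l by rewrite /=; lia.
  by move: (lP _ jl'); rewrite jl' /w; lra.
- move=> j jl; rewrite -/(avg _).
  have jm := ltn_ord j.
  have jl' : (rev_ord j).+2 = l by rewrite /=; lia.
  rewrite (_ : (m.+1 - l).+1 = m.+1 - l.-1)%N; last by lia.
  rewrite avgE; last by lia.
  by move: (lNP _ jl'); rewrite -jl' /w /=; lra.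
Qed.
End Zeta.

(* KKT: [p] is the only point of the simplex with
   |z - q|^2 >= |z - p|^2 + |p - q|^2 for all q in the simplex. *)
Lemma proj_simplex_threshold (R : realType) (n : nat) (z : 'cV[R]_n) (t : R) :
  \sum_i Num.max (z i 0 - t) 0 = 1 ->
  proj_simplex z = \col_i Num.max (z i 0 - t) 0.
Proof.
move=> sum1; set p := \col_i _.
have simp : simplex p.
  by split=> [|i]; rewrite ?mxE ?le_max ?lexx ?orbT//; under eq_bigr do rewrite mxE.
have pyth q : simplex q ->
    \sum_i (z - p) i 0 ^+ 2 + \sum_i (p - q) i 0 ^+ 2 <= \sum_i (z - q) i 0 ^+ 2.
  move=> [q1 q0]; case: simp => p1 _.
  (* Both points have mass 1, so the added term sums to 0. It makes the inequality hold in each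
     coordinate: either [p i = z i - t], or [p i = 0] and [z i <= t]. *)
  have -> : \sum_i (z - q) i 0 ^+ 2 =
      \sum_i ((z - q) i 0 ^+ 2 - 2 * t * (p - q) i 0).
    have pq0 : \sum_i (p - q) i 0 = 0.
      by under eq_bigr do rewrite mxE [(- q) _ _]mxE; rewrite sumrB p1 q1 subrr.
    by rewrite sumrB -mulr_sumr pq0 mulr0 subr0.
  rewrite -big_split; apply: ler_sum => i _ /=.
  have := q0 i; rewrite !mxE; case: (leP (z i 0 - t) 0) => ?; nra.
have sq_ge0 (x : 'cV[R]_n) : 0 <= \sum_i x i 0 ^+ 2.
  by apply: sumr_ge0 => i _; exact: sqr_ge0.
apply: xget_unique => [|q [sq qmin]].
  split=> // q /pyth ?; rewrite /enorm ler_sqrt//.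
  by have := sq_ge0 (p - q); lra.
have := qmin _ simp; rewrite /enorm ler_sqrt// => zqp.
have : \sum_i (p - q) i 0 ^+ 2 == 0.
  by rewrite eq_le sq_ge0 andbT; have := pyth _ sq; lra.
rewrite psumr_eq0 => [/allP pq0|i _]; last exact: sqr_ge0.
apply/colP => i; have := pq0 i (mem_index_enum i).
by rewrite /= sqrf_eq0 mxE [in X in _ + X]mxE subr_eq0 => /eqP.
Qed.

(** * The projection along a short segment *)

Section ProjDirection.
Variables (R : realType) (n : nat) (z d : 'cV[R]_n) (t zeta : R).

Definition proj_direction : 'cV[R]_n :=
  \col_i if t < z i 0 then d i 0 - zeta
         else if z i 0 == t then Num.max (d i 0 - zeta) 0 else 0.

Hypotheses (sum1 : \sum_i Num.max (z i 0 - t) 0 = 1)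
  (sum0 : \sum_i proj_direction i 0 = 0).

(** For small [s] no coordinate off the threshold crosses it, so [t + s * zeta] is an admissible
    threshold for the moved point: the mass stays 1 because the rates sum to 0. *)
Lemma proj_simplex_direction : exists2 e : R, 0 < e &
  forall s, 0 <= s < e ->
    proj_simplex (z + s *: d) = proj_simplex z + s *: proj_direction.
Proof.
(* Coordinate [i] moves relative to the threshold at speed [|d i - zeta|] and starts at distance
   [|z i - t|]; the summand 1 keeps the denominator positive. *)
exists (\big[Num.min/1]_(i | z i 0 != t) (`|z i 0 - t| / (1 + `|d i 0 - zeta|))).
  apply/bigmin_gtP; split=> // i it.
  by rewrite divr_gt0 ?normr_gt0 ?subr_eq0// ltr_pwDl.
move=> s /andP[s_ge0 /bigmin_gtP[_ s_lt]].
have stepE i : Num.max ((z + s *: d) i 0 - (t + s * zeta)) 0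
    = Num.max (z i 0 - t) 0 + s * proj_direction i 0.
  have [it|it] := eqVneq (z i 0) t.
    (* On the threshold the formula is the positive homogeneity of [max]. *)
    rewrite !mxE it eqxx ltxx subrr maxxx add0r maxr_pMr// mulr0.
    by congr Num.max; ring.
  have := s_lt i it; rewrite ltr_pdivlMr ?ltr_pwDl// => {}s_lt.
  have ds : `|s * (d i 0 - zeta)| < `|z i 0 - t|.
    by rewrite normrM ger0_norm//; lra.
  rewrite !mxE (negbTE it); case: ltgtP it => // it _.
    move: ds; rewrite (gtr0_norm (x := z i 0 - t)) ?subr_gt0//.
    rewrite ltr_norml => /andP[? ?].
    by rewrite (max_idPl _) ?(max_idPl _)//; lra.
  rewrite mulr0 addr0; move: ds; rewrite (ltr0_norm (x := z i 0 - t)) ?subr_lt0//.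
  rewrite ltr_norml => /andP[? ?].
  by rewrite (max_idPr _) ?(max_idPr _)//; lra.
rewrite (proj_simplex_threshold _ _ _ _ sum1) (@proj_simplex_threshold _ _ _ (t + s * zeta)).
  by apply/colP => i; rewrite mxE stepE !mxE.
by under eq_bigr do rewrite stepE; rewrite big_split/= sum1 -mulr_sumr sum0 mulr0 addr0.
Qed.

End ProjDirection.

(** * One-sided derivatives and Clarke differential at a kink *)

Section PiecewiseAffine.
Variables (R : realType) (f : R -> R) (x e p q : R).
Hypotheses (e_gt0 : 0 < e)
  (f_right : forall t, 0 <= t < e -> f (x + t) = f x + t * p)
  (f_left : forall t, 0 <= t < e -> f (x - t) = f x - t * q).

Let near_right : (\forall t \near 0^'+, diff_quotient f x t = p)%classic.
Proof.
near=> t; rewrite /diff_quotient f_right; last first.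
  by apply/andP; split; near: t; [exact: nbhs_right_ge|exact: nbhs_right_lt].
by rewrite addrC addKr mulrC mulKf//; near: t; exact: nbhs_right_neq.
Unshelve. all: by end_near. Qed.

Let near_left : (\forall t \near 0^'-, diff_quotient f x t = q)%classic.
Proof.
near=> t; have t_lt0 : t < 0 by near: t; exact: nbhs_left_lt.
have te : - e < t by near: t; apply: nbhs_left_gt; rewrite oppr_lt0.
rewrite /diff_quotient -[t in x + t]opprK f_left; last by apply/andP; split; lra.
by rewrite mulNr opprK addrC addKr mulrC mulKf ?lt_eqF.
Unshelve. all: by end_near. Qed.

Lemma right_cvg_affine : (diff_quotient f x t @[t --> 0^'+] --> p)%classic.
Proof. exact: cvg_near_cst near_right. Qed.

Lemma left_cvg_affine : (diff_quotient f x t @[t --> 0^'-] --> q)%classic.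
Proof. exact: cvg_near_cst near_left. Qed.

Let affine_derive (c s k : R) : (\near s, f s = c + (s - x) * k) ->
  derivable f s 1 /\ f^`()%classic s = k.
Proof.
move=> fk; have gk : is_derive s 1 (fun u : R => c + (u - x) * k) k.
  apply: is_derive_eq.
  by rewrite scaler0 !add0r mul1r subr0 -[_ *: _]/(_ * _) mulr1.
split; last by rewrite derive1E (near_eq_derive _ fk) derive_val.
by apply: near_eq_derivable (@ex_derive _ _ _ _ _ _ _ gk); near do symmetry; exact: fk.
Unshelve. all: by end_near. Qed.

Let right_derive s : x < s < x + e -> derivable f s 1 /\ f^`()%classic s = p.
Proof.
move=> /andP[xs se]; apply: (affine_derive (f x)).
near=> u; rewrite -f_right; first by congr f; lra.
rewrite subr_ge0 ltrBlDl; apply/andP; split; near: u.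
  by near do apply: ltW; exact: lt_nbhsr.
exact: lt_nbhsl.
Unshelve. all: by end_near. Qed.

Let left_derive s : x - e < s < x -> derivable f s 1 /\ f^`()%classic s = q.
Proof.
move=> /andP[es sx]; apply: (affine_derive (f x)).
near=> u; rewrite -(opprB x) mulNr -f_left; first by congr f; lra.
rewrite subr_ge0 ltrBlDl -ltrBlDr; apply/andP; split; near: u.
  by near do apply: ltW; exact: lt_nbhsl.
exact: lt_nbhsr.
Unshelve. all: by end_near. Qed.

(** A sequence in the Clarke differential may visit [x] itself. A two-sided derivative there is also
    the limit from the right, hence [p]. *)
Let center_derive : derivable f x 1 -> f^`()%classic x = p.
Proof.
move=> fx; rewrite derive1E /derive cvg_at_rightE//.
apply/cvg_lim => //; apply: cvg_near_cst.
near=> t; rewrite /= -[t *: _]/(t * 1) mulr1 -[_ *: _]/(_ * _) mulrC [t + x]addrC.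
rewrite -[LHS]/(diff_quotient f x t).
by near: t; exact: near_right.
Unshelve. all: by end_near. Qed.

Let near_derive s : x - e < s < x + e -> derivable f s 1 ->
  [set p; q]%classic (f^`()%classic s).
Proof.
move=> /andP[es se] fs; have [sx|xs|sx] := ltgtP s x.
- by right; rewrite (left_derive s _).2 ?es.
- by left; rewrite (right_derive s _).2 ?se ?xs.
- by left; rewrite sx center_derive// -sx.
Qed.

Let lim_right : exists s : nat -> R, [/\ (s @ \oo --> x)%classic,
  forall k, derivable f (s k) 1 & ((fun k => f^`() (s k)) @ \oo --> p)%classic].
Proof.
(* Since [harmonic k] is in (0, 1], the factor 1/2 keeps every term strictly inside the right
   interval. *)
pose s k := x + e / 2 * harmonic k.
have sP k : x < s k < x + e.
  have h0 : 0 < harmonic k :> R by exact: harmonic_gt0.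
  have h1 : harmonic k <= 1 :> R by rewrite /= invf_le1 ?ler1n ?ltr0n.
  have eh0 := mulr_gt0 e_gt0 h0.
  have eh1 : e * harmonic k <= e by rewrite ler_piMr// ltW.
  by rewrite /s; apply/andP; split; lra.
exists s; split=> [|k|]; first 1 last.
- by have [] := right_derive _ (sP k).
- by apply: cvg_near_cst; apply: nearW => k; have [] := right_derive _ (sP k).
suff : (s @ \oo --> x + e / 2 * 0)%classic by rewrite mulr0 addr0.
apply: cvgD; [exact: cvg_cst|apply: cvgM; [exact: cvg_cst|exact: cvg_harmonic]].
Qed.

Let lim_left : exists s : nat -> R, [/\ (s @ \oo --> x)%classic,
  forall k, derivable f (s k) 1 & ((fun k => f^`() (s k)) @ \oo --> q)%classic].
Proof.
pose s k := x - e / 2 * harmonic k.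
have sP k : x - e < s k < x.
  have h0 : 0 < harmonic k :> R by exact: harmonic_gt0.
  have h1 : harmonic k <= 1 :> R by rewrite /= invf_le1 ?ler1n ?ltr0n.
  have eh0 := mulr_gt0 e_gt0 h0.
  have eh1 : e * harmonic k <= e by rewrite ler_piMr// ltW.
  by rewrite /s; apply/andP; split; lra.
exists s; split=> [|k|]; first 1 last.
- by have [] := left_derive _ (sP k).
- by apply: cvg_near_cst; apply: nearW => k; have [] := left_derive _ (sP k).
suff : (s @ \oo --> x - e / 2 * 0)%classic by rewrite mulr0 subr0.
apply: cvgB; [exact: cvg_cst|apply: cvgM; [exact: cvg_cst|exact: cvg_harmonic]].
Qed.

(** Near [x] the derivative takes no values but [p] and [q], and a finite set is closed, so limits
    stay in it; both values are attained as limits, and the hull of two points is a segment. *)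
Lemma clarke_affine : clarke f x =
  [set alpha * p + (1 - alpha) * q | alpha in [set alpha | 0 <= alpha <= 1]]%classic.
Proof.
apply/seteqP; split.
  apply: smallest_sub => [u v lam|l [s [sx fs fl]]].
    rewrite !inE => -[al /= /andP[al0 al1] <-] [be /= /andP[be0 be1] <-].
    have lam0 : 0 <= lam%:num by [].
    have lam1 : lam%:num <= 1 by [].
    rewrite -[conv _ _ _]/(lam%:num * (al * p + (1 - al) * q)
      + (1 - lam%:num) * (be * p + (1 - be) * q)).
    move: (lam%:num) lam0 lam1 => {}lam lam0 lam1.
    (* The total coefficient of [p] in the combined point. *)
    exists (lam * al + (1 - lam) * be); last by ring.
    have mul (lm m : R) : 0 <= lm -> 0 <= m <= 1 -> 0 <= lm * m <= lm.
      by move=> lm0 /andP[m0 m1]; rewrite mulr_ge0// ler_piMr.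
    have /andP[? ?] : 0 <= lam * al <= lam by apply: mul => //; rewrite al0.
    have /andP[? ?] : 0 <= (1 - lam) * be <= 1 - lam.
      by apply: mul; [lra|rewrite be0].
    by apply/andP; split; lra.
  have : [set p; q]%classic l.
    apply: (@closed_cvg _ _ \oo%classic _ _ [set p; q]%classic _ _ _ fl).
      apply: accessible_finite_set_closed.1; last exact: finite_set2.
      exact: hausdorff_accessible.
    near=> k; apply: near_derive; last exact: fs.
    rewrite -ltr_distlC.
    by near: k; move/cvgrPdist_lt : sx; exact.
  move=> [->|->]; [exists 1|exists 0] => /=; rewrite ?lexx ?ler01//; ring.
move=> _ [al /= /andP[al0 al1] <-] A [Aconv Asub].
have Ap : A p by apply: Asub; exact: lim_right.
have Aq : A q by apply: Asub; exact: lim_left.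
by have := Aconv p q (Itv01 al0 al1); rewrite !inE => /(_ Ap Aq).
Unshelve. all: by end_near. Qed.

End PiecewiseAffine.

(** * Enumerations and sums over gamma1 and gamma2 *)

(** Supplies a [kapp] for the claims that mention none: existence of the derivatives, the Clarke
    formula and the case of empty gamma2. *)
Lemma exists_sorted_enum (R : realType) (n : nat) (v : 'cV[R]_n) (A : {set 'I_n}) :
  exists k : 'I_#|A| -> 'I_n,
    [/\ injective k, codom k =i A & sorts_decreasing v k].
Proof.
pose r : rel 'I_n := fun i j => v j 0 <= v i 0.
have sizeA : size (sort r (enum A)) == #|A| by rewrite size_sort -cardE.
exists (tnth (Tuple sizeA)); split.
- by apply/tuple_uniqP; rewrite sort_uniq enum_uniq.
- move=> i; rewrite -[RHS]mem_enum -[RHS](mem_sort r).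
  apply/idP/idP => [/codomP[j ->]|/(tnthP (Tuple sizeA))[j ->]].
    exact: (mem_tnth j (Tuple sizeA)).
  exact: codom_f.
- move=> i j ij; rewrite (tnth_nth (tnth (Tuple sizeA) i)) [in leRHS](tnth_nth (tnth (Tuple sizeA) i)).
  have r_total : total r by move=> ? ?; exact: le_total.
  have r_trans : transitive r by move=> ? ? ? /[swap]; exact: le_trans.
  apply: (sorted_leq_nth r_trans (fun x => lexx _) _ (sort_sorted r_total _)) => //.
    by rewrite inE (eqP sizeA).
  by rewrite inE (eqP sizeA).
Qed.

Lemma sum_codom (R : nmodType) (I J : finType) (A : {set J}) (k : I -> J) (F : J -> R) :
  injective k -> codom k =i A -> \sum_(j in A) F j = \sum_i F (k i).
Proof.
move=> k_inj kA; have -> : A = [set k i | i in I]%SET.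
  by apply/setP => j; rewrite -kA; apply/codomP/imsetP => -[i]; exists i.
by rewrite big_imset//; move=> ? ? _ _; exact: k_inj.
Qed.

(** The weight [u] is 1 for the mass balance and [a] for the slope of [psi]. *)
Lemma proj_direction_sum (R : realType) (n : nat) (z d : 'cV[R]_n) (kap : 'I_n -> 'I_n)
    (zeta : R) (u : 'I_n -> R) :
  \sum_i u i * proj_direction R n z d (tau z kap) zeta i 0 =
  \sum_(i in gamma1 z kap) u i * (d i 0 - zeta)
  + \sum_(i in gamma2 z kap) u i * Num.max (d i 0 - zeta) 0.
Proof.
rewrite (bigID (mem (gamma1 z kap)))/=; congr (_ + _).
  by apply: eq_bigr => i; rewrite inE subr_gt0 mxE => ->.
rewrite (bigID (mem (gamma2 z kap)))/= [X in _ + X]big1 ?addr0; last first.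
  move=> i; rewrite !inE mxE subr_gt0 subr_eq0 => /andP[/negbTE-> /negbTE->].
  by rewrite mulr0.
apply: eq_big => i; rewrite !inE subr_gt0 subr_eq0.
  by case: ltgtP.
by rewrite mxE => /andP[/negbTE-> ->].
Qed.

(** * The slopes of [psi] on either side of [sigma] *)

Section PsiDirection.
Variables (R : realType) (n : nat) (y a : 'cV[R]_n) (b sigma : R) (kap : 'S_n).
Let z := y - sigma *: a.
Hypotheses (n_gt0 : (0 < n)%N) (kap_sorts : sorts_decreasing z kap).

(** The sign [c] covers both sides: moving from [sigma] to [sigma - c * t] moves [z] by [t] in
    direction [c *: a], so [c] is -1 on the right and 1 on the left. *)
Lemma psi_direction (c zeta : R) :
  \sum_(i in gamma1 z kap) (c * a i 0 - zeta)
  + \sum_(i in gamma2 z kap) Num.max (c * a i 0 - zeta) 0 = 0 ->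
  exists2 e : R, 0 < e & forall t, 0 <= t < e ->
    psi y a b (sigma - c * t) = psi y a b sigma
      + t * (\sum_(i in gamma1 z kap) a i 0 * (c * a i 0 - zeta)
             + \sum_(i in gamma2 z kap) a i 0 * Num.max (c * a i 0 - zeta) 0).
Proof.
move=> sum0.
have dE i : (c *: a) i 0 - zeta = c * a i 0 - zeta by rewrite mxE.
have [||e e_gt0 projE] := proj_simplex_direction R n z (c *: a) (tau z kap) zeta.
- exact: tau_sum.
- under eq_bigr do rewrite -[proj_direction _ _ _ _ _ _ _ _]mul1r.
  rewrite (proj_direction_sum _ _ _ _ _ _ (fun=> 1)) -[RHS]sum0.
  by congr (_ + _); apply: eq_bigr => i _; rewrite mul1r dE.
exists e => // t te; rewrite /psi.
have -> : y - (sigma - c * t) *: a = z + t *: (c *: a).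
  by rewrite /z scalerBl opprB addrA addrAC scalerA [t * c]mulrC addrAC.
rewrite projE// mulmxDr -scalemxAr mxE [X in _ + X - b]mxE addrAC; congr (_ + _ * _).
rewrite mxE; under eq_bigr do rewrite mxE.
rewrite proj_direction_sum; congr (_ + _); apply: eq_bigr => i _;
by rewrite dE.
Qed.

Variable (kapp : 'I_#|gamma2 z kap| -> 'I_n).
Hypotheses (kapp_inj : injective kapp) (kapp_codom : codom kapp =i gamma2 z kap)
  (kapp_sorts : sorts_decreasing (- a) kapp).
Let K := Kbar z kap.
Let zp := zeta_plus a kap K kapp.
Let zm := zeta_minus a kap K kapp.

Lemma psi_right_affine : exists2 e : R, 0 < e & forall t, 0 <= t < e ->
  psi y a b (sigma + t) = psi y a b sigma
    + t * (\sum_(i in gamma2 z kap) a i 0 * Num.max (- a i 0 + zp) 0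
           + \sum_(i in gamma1 z kap) a i 0 * (- a i 0 + zp)).
Proof.
have [|e e_gt0 psiE] := psi_direction (-1) (- zp).
  rewrite (sum_codom _ _ _ _ _ _ kapp_inj kapp_codom).
  under [X in _ + X]eq_bigr do rewrite mulN1r opprK.
  rewrite zeta_plus_balance//; last exact: Kbar_gt0.
  rewrite (eq_bigr (fun i => zp - a i 0)); last by move=> i _; ring.
  rewrite sumrB sumr_const gamma1_sum// card_gamma1// -/K -/zp -mulr_natl.
  by ring.
exists e => // t /psiE; rewrite mulN1r opprK => ->; congr (_ + _ * _).
by rewrite addrC; congr (_ + _); apply: eq_bigr => i _; rewrite mulN1r opprK.
Qed.

Lemma psi_left_affine : exists2 e : R, 0 < e & forall t, 0 <= t < e ->
  psi y a b (sigma - t) = psi y a b sigma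
    - t * (\sum_(i in gamma2 z kap) a i 0 * Num.min (- a i 0 + zm) 0
           + \sum_(i in gamma1 z kap) a i 0 * (- a i 0 + zm)).
Proof.
have [|e e_gt0 psiE] := psi_direction 1 zm.
  rewrite (sum_codom _ _ _ _ _ _ kapp_inj kapp_codom).
  under [X in _ + X]eq_bigr do rewrite mul1r.
  rewrite zeta_minus_balance//; last exact: Kbar_gt0.
  rewrite (eq_bigr (fun i => a i 0 - zm)); last by move=> i _; ring.
  rewrite sumrB sumr_const gamma1_sum// card_gamma1// -/K -/zm -mulr_natl.
  by ring.
exists e => // t /psiE; rewrite mul1r => ->; rewrite -[in RHS]mulrN; congr (_ + _ * _).
(* The backward step reverses the sign of the slope, which turns the [max] of [a i - zm] into the
   [min] of its opposite. *)
rewrite addrC opprD -!sumrN; congr (_ + _); apply: eq_bigr => i _; rewrite mul1r.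
  by rewrite -[RHS]mulrN oppr_min oppr0 opprD opprK.
by ring.
Qed.

End PsiDirection.

Theorem mainTheorem2 (R : realType) (n : nat) (n_gt0 : (0 < n)%N)
    (y a : 'cV[R]_n) (b sigma : R) (sigma_gt0 : 0 < sigma)
    (kap : 'S_n) (kap_sorts : sorts_decreasing (y - sigma *: a) kap) :
  let z := y - sigma *: a in
  let K := Kbar z kap in
  let g1 := gamma1 z kap in
  let g2 := gamma2 z kap in
  let dplus := right_derivative (psi y a b) sigma in
  let dminus := left_derivative (psi y a b) sigma in
  [/\ right_derivable (psi y a b) sigma /\ left_derivable (psi y a b) sigma,
      clarke (psi y a b) sigma =
        [set alpha * dplus + (1 - alpha) * dminus
          | alpha in [set alpha | 0 <= alpha <= 1]]%classic,
      g2 = finset.set0 ->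
        dplus = dminus /\
        dminus = \sum_(i in g1)
          a i 0 * (- a i 0 + (\sum_(j in g1) a j 0) / #|g1|%:R) &
      g2 <> finset.set0 ->
        forall kapp : 'I_#|g2| -> 'I_n,
          injective kapp -> codom kapp =i g2 ->
          sorts_decreasing (- a) kapp ->
          let zp := zeta_plus a kap K kapp in
          let zm := zeta_minus a kap K kapp in
          dplus = \sum_(i in g2) a i 0 * Num.max (- a i 0 + zp) 0
                  + \sum_(i in g1) a i 0 * (- a i 0 + zp) /\
          dminus = \sum_(i in g2) a i 0 * Num.min (- a i 0 + zm) 0
                   + \sum_(i in g1) a i 0 * (- a i 0 + zm)].
Proof.
move=> z K g1 g2 dplus dminus.
have affine p q e1 e2 : 0 < e1 -> 0 < e2 ->
    (forall t, 0 <= t < e1 -> psi y a b (sigma + t) = psi y a b sigma + t * p) ->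
    (forall t, 0 <= t < e2 -> psi y a b (sigma - t) = psi y a b sigma - t * q) ->
    [/\ right_derivable (psi y a b) sigma /\ left_derivable (psi y a b) sigma,
        dplus = p, dminus = q &
        clarke (psi y a b) sigma =
        [set alpha * dplus + (1 - alpha) * dminus
          | alpha in [set alpha | 0 <= alpha <= 1]]%classic].
  (* The two sides come with different radii; the lemmas on kinks take a common one. *)
  move=> e1_gt0 e2_gt0 fr fl; pose e := Num.min e1 e2.
  have e_gt0 : 0 < e by rewrite lt_min e1_gt0.
  have {}fr t : 0 <= t < e -> psi y a b (sigma + t) = psi y a b sigma + t * p.
    by rewrite lt_min => /and3P[t0 te _]; rewrite fr// t0.
  have {}fl t : 0 <= t < e -> psi y a b (sigma - t) = psi y a b sigma - t * q.
    by rewrite lt_min => /and3P[t0 _ te]; rewrite fl// t0.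
  have cr := right_cvg_affine R _ _ _ _ e_gt0 fr.
  have cl := left_cvg_affine R _ _ _ _ e_gt0 fl.
  have dp : dplus = p by exact/cvg_lim.
  have dm : dminus = q by exact/cvg_lim.
  split=> //; first by split; apply/cvg_ex; [exists p|exists q].
  by rewrite dp dm; apply: clarke_affine e_gt0 fr fl.
have K_neq0 : K%:R != 0 :> R by rewrite pnatr_eq0 -lt0n Kbar_gt0.
have g1_sum := gamma1_sum R n z kap n_gt0 kap_sorts a.
have g1_card := card_gamma1 R n z kap n_gt0 kap_sorts.
have derivs (kapp : 'I_#|g2| -> 'I_n) (kapp_inj : injective kapp)
    (kapp_codom : codom kapp =i g2) (kapp_sorts : sorts_decreasing (- a) kapp) :=
  let: ex_intro2 e1 e1_gt0 fr := psi_right_affine R n y a b sigma kap n_gt0 kap_sorts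
    kapp kapp_inj kapp_codom kapp_sorts in
  let: ex_intro2 e2 e2_gt0 fl := psi_left_affine R n y a b sigma kap n_gt0 kap_sorts
    kapp kapp_inj kapp_codom kapp_sorts in
  affine _ _ _ _ e1_gt0 e2_gt0 fr fl.
have [kapp0 [inj0 codom0 sorts0]] := exists_sorted_enum R n (- a) g2.
have [dd dp dm cl] := derivs kapp0 inj0 codom0 sorts0.
split=> // [g20|_ kapp kapp_inj kapp_codom kapp_sorts]; last first.
  by have [_ dp' dm' _] := derivs kapp kapp_inj kapp_codom kapp_sorts.
(* With gamma2 empty the left sides of both balance identities vanish, so [zeta_plus] and
   [zeta_minus] both equal the mean of [a] over gamma1. *)
have mean x : K%:R * x = prefix_sum a kap K -> x = (\sum_(j in g1) a j 0) / #|g1|%:R.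
  by rewrite g1_sum g1_card -/K => <-; rewrite mulrC mulKf.
have no_j (F : 'I_#|g2| -> R) : \sum_j F j = 0.
  by rewrite big_pred0// => -[j]; rewrite g20 cards0.
have zpE : zeta_plus a kap K kapp0 = (\sum_(j in g1) a j 0) / #|g1|%:R.
  apply: mean; have := zeta_plus_balance R n _ a kap K kapp0
    (Kbar_gt0 _ _ _ _ n_gt0) sorts0.
  by rewrite /= no_j; lra.
have zmE : zeta_minus a kap K kapp0 = (\sum_(j in g1) a j 0) / #|g1|%:R.
  apply: mean; have := zeta_minus_balance R n _ a kap K kapp0
    (Kbar_gt0 _ _ _ _ n_gt0) sorts0.
  by rewrite /= no_j; lra.
have no_i (F : 'I_n -> R) : \sum_(i in g2) F i = 0 by rewrite g20 big_set0.
by rewrite dp dm !no_i !add0r zpE zmE.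
Qed.
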